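(* For every homogeneous polynomial $f$ over $\mathbb{C}$, $\underline{\mathsf{WR}}(f) \le \underline{\textup{\textsf{Kc}}}^-(f)$.
   Context: $\underline{\textup{\textsf{Kc}}}^-(f)$ is the smallest $m$ such that there exist an integer $M\ge 1$, $\gamma\in\mathbb{C}$ and homogeneous linear forms $\ell_1,\ldots,\ell_m$ in the variables $\mathbf{x}$ with coefficients in $\mathbb{C}[\varepsilon,\varepsilon^{-1}]$ such that $\gamma\varepsilon^{-M}\big(\prod_{i=1}^m(1+\ell_i)-1\big)$ has a limit as $\varepsilon\to 0$ (coefficientwise) equal to $f$; it is $\infty$ if no such $m$ exists. The border Waring rank $\underline{\mathsf{WR}}(f)$ of a homogeneous degree-$d$ polynomial $f$ is the smallest $r$ with $f=\lim_{\varepsilon\to0}\sum_{i=1}^r \ell_i(\varepsilon)^d$ for linear forms $\ell_i$ with coefficients in $\mathbb{C}(\varepsilon)$. *)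

(* Defs.v *)
(* The complex field is R[i], with R : realType. *)
From mathcomp Require Import all_boot all_order all_algebra fraction.
From mathcomp Require Import complex.
(* mpoly must be imported before MathComp-Analysis: in the other order their   *)
(* notations clash.                                                            *)
From mathcomp Require Import mpoly.
From mathcomp Require Import classical_sets reals constructive_ereal ereal.
From mathcomp Require Import topology normedtype.

Set Implicit Arguments.
Unset Strict Implicit.
Unset Printing Implicit Defensive.

Import Order.TTheory GRing.Theory Num.Theory.

Local Open Scope ring_scope.
Local Open Scope classical_set_scope.


Section Defs.
Variable R : realType.

Local Notation C := R[i].
Local Notation K := {fraction {poly C}}.

(* eps is the indeterminate, K = C(eps). *)
Definition eps : K := tofrac 'X.

Definition cstK (c : C) : K := tofrac c%:P.

Definition is_laurent (x : K) : Prop :=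
  exists (p : {poly C}) (k : nat), x = tofrac p / eps ^+ k.

(* The value at z of the representative fraction of x chosen by the quotient.  *)
(* Two representatives agree at every z that is a root of neither denominator, *)
(* hence on a punctured neighbourhood of 0: the limit at 0 below does not      *)
(* depend on this choice.                                                      *)
Definition evalK (x : K) (z : C) : C :=
  (frac (repr x)).1.[z] / (frac (repr x)).2.[z].

(* The limit is taken in the usual topology of C, carried by C^o. *)
Definition lim0_eq (x : K) (c : C) : Prop :=
  (evalK x z : C^o) @[z --> (0 : C^o)^'] --> (c : C^o).

Definition mlim0_eq n (F : {mpoly K[n]}) (f : {mpoly C[n]}) : Prop :=
  forall m : 'X_{1..n}, lim0_eq F@_m f@_m.

(* The zero form is 1.-homog. *)
Definition linform n (l : {mpoly K[n]}) : Prop := l \is 1.-homog.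

Definition linform_laurent n (l : {mpoly K[n]}) : Prop :=
  linform l /\ forall m : 'X_{1..n}, is_laurent l@_m.

Definition Kc_minus_repr n (f : {mpoly C[n]}) (m : nat) : Prop :=
  exists (M : nat) (gamma : C) (l : 'I_m -> {mpoly K[n]}),
    [/\ (1 <= M)%N,
        forall i, linform_laurent (l i) &
        mlim0_eq ((cstK gamma * eps ^- M) *: (\prod_(i < m) (1 + l i) - 1)) f].

Definition WR_border_repr n (d : nat) (f : {mpoly C[n]}) (r : nat) : Prop :=
  exists l : 'I_r -> {mpoly K[n]},
    (forall i, linform (l i)) /\ mlim0_eq (\sum_(i < r) l i ^+ d) f.

(* The smallest element of P, and +oo if P is empty. *)
Definition least (P : set nat) : \bar R :=
  ereal_inf [set ((m%:R : R)%:E)%E | m in P].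

Definition Kc_minus_border n (f : {mpoly C[n]}) : \bar R :=
  least (Kc_minus_repr f).

(* Border Waring rank of f as a form of degree d. The degree is explicit only  *)
(* because the zero polynomial is homogeneous of every degree.                 *)
Definition WR_border n (d : nat) (f : {mpoly C[n]}) : \bar R :=
  least (WR_border_repr d f).

End Defs.

(* Main.v *)
(* Split prod_i (1 + l_i) by degree: its part of degree k is the elementary
   symmetric polynomial e_k(l), so the hypothesis says that e_k(l) = O(eps^M) for
   every k > 0, the limit of gamma eps^-M e_k(l) being f for k = d and 0 otherwise.
   By Newton's identities p_d(l) = (-1)^(d-1) d e_d(l) up to products of two terms
   of order eps^M, so gamma eps^-M p_d(l) tends to (-1)^(d-1) d f.  After the
   substitution eps -> eps^d the factor eps^-M becomes a d-th power, and together
   with the constant it can be absorbed in the linear forms: f is a limit of sums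
   of m d-th powers. *)
From HB Require Import structures.
Require Import Defs.
From mathcomp Require Import all_boot all_order all_algebra fraction.
From mathcomp Require Import generic_quotient complex.
From mathcomp Require Import mpoly.
From mathcomp Require Import boolp classical_sets functions.
From mathcomp Require Import reals constructive_ereal ereal.
From mathcomp Require Import topology normedtype.
From mathcomp Require Import ring.

Set Implicit Arguments.
Unset Strict Implicit.
Unset Printing Implicit Defensive.

Import Order.TTheory GRing.Theory Num.Theory.
Import numFieldNormedType.Exports.

Local Open Scope classical_set_scope.
Local Open Scope ring_scope.

(** * Fraction fields and the maps induced between them *)

Lemma fracE (A : idomainType) (x : {fraction A}) :
  x = tofrac \n_(repr x) / tofrac \d_(repr x).
Proof.
have dN0 : tofrac \d_(repr x) != 0 by rewrite tofrac_eq0 denom_ratioP.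
apply: (canRL (mulfK dN0)).
rewrite -[x in LHS]reprK; unlock tofrac.
rewrite -[LHS]FracField.pi_mul; apply/eqmodP.
rewrite /= FracField.equivfE /FracField.mulf /=.
rewrite !numden_Ratio ?mulf_neq0 ?oner_eq0 ?denom_ratioP //.
by rewrite reprK !mulr1 mulrC.
Qed.

Lemma tofrac_div_eq (A : idomainType) (a b p q : A) : b != 0 -> q != 0 ->
  (tofrac a / tofrac b == tofrac p / tofrac q) = (a * q == p * b).
Proof.
move=> bN0 qN0.
by rewrite eqr_div ?tofrac_eq0 // -!tofracM tofrac_eq.
Qed.

Section FractionMap.
Variables A B : idomainType.
Variable f : {rmorphism A -> B}.
Hypothesis f_inj : injective f.

(* [fracmap] is a ring morphism only for injective [f]: the proof argument allows
   canonical instances to be declared on it. *)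
Definition fracmap of injective f := fun x : {fraction A} =>
  tofrac (f \n_(repr x)) / tofrac (f \d_(repr x)) : {fraction B}.

(** Independence of the chosen representative: [f] transports the cross-multiplied equality, and its
    injectivity keeps the denominators nonzero. *)
Lemma fracmapE (p q : A) : q != 0 ->
  fracmap f_inj (tofrac p / tofrac q) = tofrac (f p) / tofrac (f q).
Proof.
move=> qN0; rewrite /fracmap; set x := tofrac p / tofrac q.
have dN0 := denom_ratioP (repr x).
apply/eqP; rewrite tofrac_div_eq ?(raddf_eq0 _ f_inj) // -!rmorphM (inj_eq f_inj).
by rewrite -tofrac_div_eq // -fracE.
Qed.

Lemma fracmap_tofrac (p : A) : fracmap f_inj (tofrac p) = tofrac (f p).
Proof.
have := @fracmapE p 1; rewrite oner_neq0 => /(_ isT).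
by rewrite !rmorph1 !divr1.
Qed.

Lemma fracmap_is_zmod_morphism : zmod_morphism (fracmap f_inj).
Proof.
move=> x y; rewrite [x]fracE [y]fracE !fracmapE ?denom_ratioP //.
set a := \n_ _; set b := \d_ _; set c := \n_ _; set e := \d_ _.
have bN0 : b != 0 by apply: denom_ratioP.
have eN0 : e != 0 by apply: denom_ratioP.
have -> : tofrac a / tofrac b - tofrac c / tofrac e =
          tofrac (a * e - c * b) / tofrac (b * e).
  by rewrite -mulNr addf_div ?tofrac_eq0 // -!tofracN -!tofracM -!tofracD mulNr.
rewrite fracmapE ?mulf_neq0 // -[in RHS]mulNr.
rewrite addf_div ?tofrac_eq0 ?(raddf_eq0 _ f_inj) //.
by rewrite -tofracN -!tofracM -tofracD rmorphB !rmorphM mulNr.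
Qed.

Lemma fracmap_is_monoid_morphism : monoid_morphism (fracmap f_inj).
Proof.
split=> [|x y]; first by rewrite -[1]tofrac1 fracmap_tofrac !rmorph1.
rewrite [x]fracE [y]fracE !fracmapE ?denom_ratioP //.
rewrite mulf_div -!tofracM fracmapE ?mulf_neq0 ?denom_ratioP //.
by rewrite !rmorphM mulf_div.
Qed.

HB.instance Definition _ := GRing.isZmodMorphism.Build
  {fraction A} {fraction B} (fracmap f_inj) fracmap_is_zmod_morphism.
HB.instance Definition _ := GRing.isMonoidMorphism.Build
  {fraction A} {fraction B} (fracmap f_inj) fracmap_is_monoid_morphism.

End FractionMap.

(** * Newton's identities and homogeneity of the elementary symmetric polynomials *)

Section Newton.
Variable A : comNzRingType.
Implicit Types (l : A) (s : seq A).

(** Generating polynomial of the elementary symmetric polynomials: its coefficient of index [k] is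
    $e_k(s)$. *)
Definition esym_poly s : {poly A} := \prod_(l <- s) (1 + l *: 'X).

Lemma coef_esym_poly_cons l s k :
  (esym_poly (l :: s))`_k.+1 = (esym_poly s)`_k.+1 + l * (esym_poly s)`_k.
Proof.
by rewrite /esym_poly big_cons mulrDl mul1r coefD -scalerAl coefZ coefXM.
Qed.

Lemma coef0_esym_poly s : (esym_poly s)`_0 = 1.
Proof.
rewrite /esym_poly; elim: s => [|l s IHs]; first by rewrite big_nil coef1.
by rewrite big_cons mulrDl mul1r coefD -scalerAl coefZ coefXM mulr0 addr0.
Qed.

(** This is the coefficient of degree [k] in $\frac{l}{1+lX} E_{l::s} = l E_s$, where $E$ is
    [esym_poly] and the fraction is expanded as a geometric series. *)
Lemma alt_sum_coef_esym_poly l s k :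
  \sum_(i < k.+1) (-1) ^+ i * (esym_poly (l :: s))`_(k - i) * l ^+ i.+1 =
  l * (esym_poly s)`_k.
Proof.
elim: k => [|k IHk]; first by rewrite big_ord1 subn0 !coef0_esym_poly !mul1r mulr1.
rewrite big_ord_recl subn0 coef_esym_poly_cons.
under eq_bigr => i _ do
  rewrite lift0 subSS exprS mulN1r (exprSr l i.+1) !mulNr mulrA.
by rewrite sumrN -mulr_suml IHk; ring.
Qed.

(** Induction on [s]: the powers of the new element [l] contribute $l\,e_k(s)$ by the previous
    lemma, and this is one of the [k.+1] copies of $l\,e_k(s)$ on the left. *)
Lemma newton_identity s k :
  (esym_poly s)`_k.+1 *+ k.+1 =
  \sum_(i < k.+1) (-1) ^+ i * (esym_poly s)`_(k - i) * \sum_(l <- s) l ^+ i.+1.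
Proof.
elim: s k => [|l s IHs] k.
  rewrite /esym_poly big_nil coef1 mul0rn big1 // => i _.
  by rewrite big_nil mulr0.
under eq_bigr do rewrite big_cons mulrDr.
rewrite big_split /= alt_sum_coef_esym_poly coef_esym_poly_cons mulrnDl.
rewrite (mulrS (l * _)) addrCA; congr (_ + _).
case: k => [|k].
  by rewrite mulr0n addr0 IHs !big_ord1 subn0 !coef0_esym_poly.
(* The induction hypothesis is used in two consecutive degrees. The last term is split off because
   $e_0 = 1$ does not follow the recurrence in [l]. *)
rewrite -mulrnAr !IHs big_ord_recr [in RHS]big_ord_recr /= subnn.
rewrite !coef0_esym_poly addrAC; congr (_ + _).
rewrite mulr_sumr -big_split; apply: eq_bigr => i _ /=.
by rewrite subSn -1?ltnS // coef_esym_poly_cons; ring.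
Qed.

(** The term [i = k] of Newton's identity has $e_0 = 1$ and is isolated; every product that remains
    has two factors of positive degree. *)
Lemma power_sumE s k :
  \sum_(l <- s) l ^+ k.+1 = (-1) ^+ k * ((esym_poly s)`_k.+1 *+ k.+1 -
    \sum_(i < k) (-1) ^+ i * (esym_poly s)`_(k - i) * \sum_(l <- s) l ^+ i.+1).
Proof.
rewrite newton_identity big_ord_recr /= subnn coef0_esym_poly mulr1.
by rewrite addrAC subrr add0r signrMK.
Qed.
End Newton.

Section NewtonHomog.
Variables (A : comNzRingType) (n : nat) (s : seq {mpoly A[n]}).
Hypothesis s_lin : {in s, forall l, l \is 1.-homog}.

Lemma coef_esym_poly_homog k : (esym_poly s)`_k \is k.-homog.
Proof.
elim: s s_lin k => [_|l t IHt lt_lin] [|k]; rewrite ?coef0_esym_poly ?dhomog1 //.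
  by rewrite /esym_poly big_nil coef1 dhomog0.
have t_lin : {in t, forall l, l \is 1.-homog}.
  by move=> x xt; apply: lt_lin; rewrite inE xt orbT.
rewrite coef_esym_poly_cons dhomogD ?IHt //.
by rewrite -add1n dhomogM ?IHt ?lt_lin ?mem_head.
Qed.

(** The product is [esym_poly s] at 1, that is $\sum_k e_k(s)$, and only the summand of degree
    [mdeg m] can contain the monomial [m]. *)
Lemma mcoeff_prod_linform m :
  (\prod_(l <- s) (1 + l))@_m = ((esym_poly s)`_(mdeg m))@_m.
Proof.
have -> : \prod_(l <- s) (1 + l) = (esym_poly s).[1].
  by rewrite horner_prod; apply: eq_bigr => l _; rewrite !hornerE.
(* The range of summation is widened so that the index [mdeg m] occurs even beyond the degree of
   [esym_poly s]. *)
rewrite (horner_coef_wide _ (leq_maxl _ (mdeg m).+1)).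
rewrite raddf_sum /= (bigD1 (Ordinal (leq_maxr _ _))) //= expr1n mulr1.
rewrite big1 ?addr0 // => i; rewrite -val_eqE /= eq_sym => m_i.
by rewrite expr1n mulr1 (dhomog_nemf_coeff (coef_esym_poly_homog i)).
Qed.
End NewtonHomog.

Lemma map_mpoly_homog (A B : nzRingType) (n d : nat) (phi : {rmorphism A -> B})
    (p : {mpoly A[n]}) : p \is d.-homog -> map_mpoly phi p \is d.-homog.
Proof.
move=> p_hom; apply/dhomogP => m; rewrite mcoeff_msupp mcoeff_map_mpoly => pm.
apply: (dhomog_mf p_hom); rewrite mcoeff_msupp.
apply: contraNneq pm => ->; by rewrite raddf0.
Qed.

(** * Continuity of polynomial functions and of their quotients *)

Lemma horner_neq0 (A : nzRingType) (p : {poly A}) (c : A) : p.[c] != 0 -> p != 0.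
Proof. by apply: contraNneq => ->; rewrite horner0. Qed.

Lemma continuous_horner_numField (F : numFieldType) (p : {poly F}) :
  continuous (horner p : F^o -> F^o).
Proof.
elim/poly_ind: p => [|p c IHp] a.
  have -> : horner (0 : {poly F}) = cst 0 :> (F^o -> F^o).
    by apply/funext => z; rewrite horner0.
  exact: cst_continuous.
have -> : horner (p * 'X + c%:P) = (horner p \* id) \+ cst c :> (F^o -> F^o).
  by apply/funext => z; rewrite hornerMXaddC.
apply: (@continuousD F F^o F^o); last exact: cst_continuous.
by apply: (@continuousM F F^o (horner p) id); [apply: IHp|apply: cvg_id].
Qed.

Lemma cvg_horner_div (F : numFieldType) (p q : {poly F}) : q.[0] != 0 ->
  (p.[z] / q.[z] : F^o) @[z --> (0 : F^o)^'] --> (p.[0] / q.[0] : F^o).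
Proof.
move=> qN0; apply: (@cvgM F F^o _ _ (horner p) (fun z => q.[z]^-1)).
  exact: cvg_within_filter (@continuous_horner_numField _ p 0).
apply: (@cvgV F F^o) => //.
exact: cvg_within_filter (@continuous_horner_numField _ q 0).
Qed.

Lemma mulf_expB_ge (F : fieldType) (a b t : F) (k j : nat) :
  t != 0 -> (k <= j)%N -> a * t ^+ j / (b * t ^+ k) = a * t ^+ (j - k) / b.
Proof.
move=> tN0 le_kj; rewrite -{1}(subnK le_kj) exprD mulrA -mulf_div.
by rewrite divff ?expf_neq0 // mulr1.
Qed.

Lemma mulf_expB_le (F : fieldType) (a b t : F) (k j : nat) :
  t != 0 -> (j <= k)%N -> a * t ^+ j / (b * t ^+ k) * t ^+ (k - j) = a / b.
Proof.
move=> tN0 le_jk; rewrite mulrAC -(mulrA a) -exprD subnKC // -mulf_div.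
by rewrite divff ?expf_neq0 // mulr1.
Qed.

(** * Limits at 0 in $\mathbb{C}(\varepsilon)$, described algebraically *)

Section Limits.
Variable R : realType.
Local Notation C := R[i].
Local Notation K := {fraction {poly C}}.
Implicit Types (x y : K) (c e : C) (p q : {poly C}).

(** Algebraic counterpart of [lim0_eq]: [x] lies in the local ring at 0 and [c] is its residue.
    Compatibility with the ring operations is then a computation on fractions. *)
Definition regular_at0 x c := exists p q,
  [/\ q.[0] != 0, x = tofrac p / tofrac q & c = p.[0] / q.[0]].

Lemma regular_at0_poly p : regular_at0 (tofrac p) p.[0].
Proof. by exists p, 1; rewrite hornerC oner_neq0 tofrac1 !divr1. Qed.

Lemma regular_at0_cst c : regular_at0 (cstK c) c.
Proof. by have := regular_at0_poly c%:P; rewrite hornerC. Qed.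

Lemma regular_at0D x y c e :
  regular_at0 x c -> regular_at0 y e -> regular_at0 (x + y) (c + e).
Proof.
move=> [p [q [qN0 -> ->]]] [p' [q' [q'N0 -> ->]]].
exists (p * q' + p' * q), (q * q'); split; first by rewrite hornerM mulf_neq0.
  by rewrite addf_div ?tofrac_eq0 ?(@horner_neq0 _ _ 0) // -!tofracM -tofracD.
by rewrite addf_div // hornerD !hornerM.
Qed.

Lemma regular_at0M x y c e :
  regular_at0 x c -> regular_at0 y e -> regular_at0 (x * y) (c * e).
Proof.
move=> [p [q [qN0 -> ->]]] [p' [q' [q'N0 -> ->]]].
exists (p * p'), (q * q'); split; first by rewrite hornerM mulf_neq0.
  by rewrite mulf_div -!tofracM.
by rewrite mulf_div !hornerM.
Qed.

(** Once the largest power of ['X] is factored out, the cofactor is nonzero at 0, hence near 0 by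
    continuity. *)
Lemma near0_horner_neq0 p : p != 0 -> \forall z \near (0 : C^o)^', p.[z] != 0.
Proof.
move=> pN0; have [k [q]] := multiplicity_XsubC p 0.
rewrite pN0 /= => qN0 ->.
have : \forall z \near (0 : C^o)^', q.[z] != 0.
  apply: (@cvgr_neq0 _ C^o _ _ _ (fun z => q.[z]) q.[0]) => //.
  exact: cvg_within_filter (@continuous_horner_numField _ q 0).
have := @nbhs_dnbhs_neq C^o 0.
apply: filterS2 => z zN0 qzN0.
by rewrite hornerM horner_exp !hornerE mulf_neq0 // expf_neq0 // subr0.
Qed.

Lemma near0_evalK p q : q != 0 ->
  \forall z \near (0 : C^o)^', p.[z] / q.[z] = evalK (tofrac p / tofrac q) z.
Proof.
move=> qN0; set x := tofrac p / tofrac q; have dN0 := denom_ratioP (repr x).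
have /eqP : x = tofrac p / tofrac q by [].
rewrite {1}[x]fracE tofrac_div_eq // => /eqP xE.
apply: filterS2 (near0_horner_neq0 qN0) (near0_horner_neq0 dN0) => z qz dz.
by apply/eqP; rewrite eqr_div // -!hornerM xE.
Qed.

Lemma regular_at0_lim0_eq x c : regular_at0 x c -> lim0_eq x c.
Proof.
move=> [p [q [qN0 -> ->]]]; rewrite /lim0_eq.
apply: cvg_trans (near_eq_cvg (near0_evalK p (horner_neq0 qN0))) _.
exact: cvg_horner_div.
Qed.

Lemma lim0_eq_uniq x c e : lim0_eq x c -> lim0_eq x e -> c = e.
Proof. exact: (@cvg_unique C^o (@norm_hausdorff _ C^o)). Qed.

(** The representative chosen for [x * y] need not be the product of the chosen ones, but their
    values agree on a punctured neighbourhood of 0. *)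
Lemma lim0_eqM x y c e : lim0_eq x c -> lim0_eq y e -> lim0_eq (x * y) (c * e).
Proof.
move=> xc ye; rewrite /lim0_eq.
apply: cvg_trans _ (@cvgM C C^o _ _ (evalK x) (evalK y) c e xc ye).
apply: near_eq_cvg.
have xdN0 := denom_ratioP (repr x); have ydN0 := denom_ratioP (repr y).
have := near0_evalK (\n_(repr x) * \n_(repr y)) (mulf_neq0 xdN0 ydN0).
rewrite !tofracM -mulf_div -!fracE; apply: filterS => z <-.
by rewrite /evalK !hornerM /= mulf_div.
Qed.

(** A nonzero [x] is $\varepsilon^j p / (\varepsilon^k q)$ with $p(0), q(0) \ne 0$. If $j < k$, then
    $x\varepsilon^{k-j}$ would tend both to $c \cdot 0 = 0$ and to $p(0)/q(0) \ne 0$; so there is no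
    pole. *)
Lemma lim0_eq_regular_at0 x c : lim0_eq x c -> regular_at0 x c.
Proof.
move=> xc; have dN0 := denom_ratioP (repr x).
have [k [q]] := multiplicity_XsubC \d_(repr x) 0.
have [j [p]] := multiplicity_XsubC \n_(repr x) 0.
rewrite dN0 subr0 /= => pN0 nE qN0 dE.
have [n0|nN0] := eqVneq \n_(repr x) 0.
  have x0 : x = 0 by rewrite [x]fracE n0 tofrac0 mul0r.
  have r0 : regular_at0 x 0.
    by rewrite x0; have := regular_at0_cst 0; rewrite /cstK tofrac0.
  by rewrite (lim0_eq_uniq xc (regular_at0_lim0_eq r0)).
rewrite nN0 /= in pN0.
have XN0 : tofrac 'X != 0 :> K by rewrite tofrac_eq0 polyX_eq0.
have xE : x = tofrac p * eps R ^+ j / (tofrac q * eps R ^+ k).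
  by rewrite {1}[x]fracE nE dE !tofracM !tofracXn.
have [le_kj|lt_jk] := leqP k j.
  have rx : regular_at0 x ((p * 'X^(j - k)).[0] / q.[0]).
    exists (p * 'X^(j - k)), q; split => //.
    by rewrite xE mulf_expB_ge // tofracM tofracXn.
  by rewrite (lim0_eq_uniq xc (regular_at0_lim0_eq rx)).
have rx : regular_at0 (x * eps R ^+ (k - j)) (p.[0] / q.[0]).
  by exists p, q; split => //; rewrite xE mulf_expB_le // ltnW.
have re : regular_at0 (eps R ^+ (k - j)) 0.
  have := regular_at0_poly 'X^(k - j).
  by rewrite tofracXn hornerXn expr0n subn_eq0 leqNgt lt_jk.
have := lim0_eqM xc (regular_at0_lim0_eq re).
rewrite mulr0 => /lim0_eq_uniq/(_ (regular_at0_lim0_eq rx))/esym/eqP.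
rewrite mulf_eq0 invr_eq0 => /orP[/eqP p0|/eqP q0].
  by rewrite /root p0 eqxx in pN0.
by rewrite /root q0 eqxx in qN0.
Qed.

Lemma lim0_eqP x c : lim0_eq x c <-> regular_at0 x c.
Proof. by split; [apply: lim0_eq_regular_at0|apply: regular_at0_lim0_eq]. Qed.

Lemma regular_at0_sum (I : Type) (r : seq I) (P : pred I)
    (F : I -> K) (g : I -> C) :
  (forall i, P i -> regular_at0 (F i) (g i)) ->
  regular_at0 (\sum_(i <- r | P i) F i) (\sum_(i <- r | P i) g i).
Proof.
move=> Fg; elim/big_rec2: _ => [|i x y Pi xy]; last first.
  by apply: regular_at0D => //; apply: Fg.
by have := regular_at0_cst 0; rewrite /cstK tofrac0.
Qed.

Variable n : nat.
Implicit Types (F G : {mpoly K[n]}) (f g : {mpoly C[n]}).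

Definition mregular_at0 F f := forall m, regular_at0 F@_m f@_m.

Lemma mlim0_eqP F f : mlim0_eq F f <-> mregular_at0 F f.
Proof. by split=> Ff m; apply/lim0_eqP. Qed.

Lemma mregular_at0D F G f g :
  mregular_at0 F f -> mregular_at0 G g -> mregular_at0 (F + G) (f + g).
Proof. by move=> Ff Gg m; rewrite !mcoeffD; apply: regular_at0D. Qed.

Lemma mregular_at0Z x c F f :
  regular_at0 x c -> mregular_at0 F f -> mregular_at0 (x *: F) (c *: f).
Proof. by move=> xc Ff m; rewrite !mcoeffZ; apply: regular_at0M. Qed.

Lemma regular_at0_nat k : regular_at0 k%:R k%:R.
Proof. by have := regular_at0_cst k%:R; rewrite /cstK !rmorph_nat. Qed.

Lemma regular_at0N x c : regular_at0 x c -> regular_at0 (- x) (- c).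
Proof.
move=> xc; rewrite -mulN1r -(mulN1r c); apply: regular_at0M => //.
by have := regular_at0_cst (- 1); rewrite /cstK !rmorphN1.
Qed.

Lemma mregular_at0N F f : mregular_at0 F f -> mregular_at0 (- F) (- f).
Proof. by move=> Ff m; rewrite !mcoeffN; apply: regular_at0N. Qed.

Lemma mregular_at0Mn F f k : mregular_at0 F f -> mregular_at0 (F *+ k) (f *+ k).
Proof.
move=> Ff m; rewrite !mcoeffMn -mulr_natl -(mulr_natl (f@_m)).
by apply: regular_at0M => //; apply: regular_at0_nat.
Qed.

Lemma mregular_at0_sign k : mregular_at0 ((-1) ^+ k) ((-1) ^+ k).
Proof.
rewrite -signr_odd -[in X in mregular_at0 _ X]signr_odd.
have m1 : mregular_at0 1 1 by move=> m; rewrite !mcoeff1; apply: regular_at0_nat.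
by case: odd => //; rewrite !expr1; apply: mregular_at0N.
Qed.

Lemma mregular_at0M F G f g :
  mregular_at0 F f -> mregular_at0 G g -> mregular_at0 (F * G) (f * g).
Proof.
move=> Ff Gg m; rewrite !mcoeffM.
by apply: regular_at0_sum => k _; apply: regular_at0M.
Qed.

Lemma mregular_at0_sum (I : Type) (r : seq I) (P : pred I)
    (F : I -> {mpoly K[n]}) (g : I -> {mpoly C[n]}) :
  (forall i, P i -> mregular_at0 (F i) (g i)) ->
  mregular_at0 (\sum_(i <- r | P i) F i) (\sum_(i <- r | P i) g i).
Proof.
by move=> Fg m; rewrite !raddf_sum; apply: regular_at0_sum => i /Fg; apply.
Qed.

(** Strong induction on [k]: in [power_sumE] both factors of each product are [u] times a convergent
    family, so the product divided by [u] still carries a factor [u] and tends to 0. *)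
Lemma power_sum_mregular_at0 (s : seq {mpoly K[n]}) (u : K)
    (h : nat -> {mpoly C[n]}) :
    u != 0 -> regular_at0 u 0 ->
    (forall k, mregular_at0 (u^-1 *: (esym_poly s)`_k.+1) (h k)) ->
  forall k, mregular_at0 (u^-1 *: \sum_(l <- s) l ^+ k.+1)
                         ((-1) ^+ k * (h k *+ k.+1)).
Proof.
move=> uN0 u0 eh k; have [j le_kj] := ubnP k.
elim: j k le_kj => // j IHj k lt_kj.
rewrite power_sumE scalerAr scalerBr scaler_sumr -scalerMnr.
apply: mregular_at0M; first exact: mregular_at0_sign.
(* The zero limit of the products is written as a sum of the limits of the terms, where [0] is the
   limit of the remaining factor [u]. *)
have sum0 : \sum_(i < k) (-1) ^+ i *
    ((0 : C) *: (h (k - i).-1 * ((-1) ^+ i * (h i *+ i.+1)))) = 0.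
  by rewrite big1 // => i _; rewrite scale0r mulr0.
rewrite -[h k *+ _]subr0 -sum0.
apply: mregular_at0D; first exact: mregular_at0Mn.
apply: mregular_at0N; apply: mregular_at0_sum => i _.
(* As [i < k], the index [k - i] is positive and can be put in the successor form that [eh]
   requires. *)
have -> : u^-1 *: ((-1) ^+ i * (esym_poly s)`_(k - i) * \sum_(l <- s) l ^+ i.+1) =
    (-1) ^+ i * (u *: ((u^-1 *: (esym_poly s)`_(k - i).-1.+1) *
       (u^-1 *: \sum_(l <- s) l ^+ i.+1))).
  rewrite prednK ?subn_gt0 // -mulrA scalerAr; congr (_ * _).
  by rewrite -scalerAr -scalerAl !scalerA mulfV // mul1r.
apply: mregular_at0M; first exact: mregular_at0_sign.
apply: mregular_at0Z => //; apply: mregular_at0M => //.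
by apply: IHj; exact: leq_trans (ltn_ord i) lt_kj.
Qed.

End Limits.

(** * The substitution $\varepsilon \mapsto \varepsilon^d$ *)

Section Substitution.
Variables (R : realType) (d : nat).
Hypothesis d_gt0 : (0 < d)%N.
Local Notation C := R[i].
Local Notation K := {fraction {poly C}}.

Lemma comp_polyXn_inj : injective (comp_poly 'X^d : {poly C} -> {poly C}).
Proof.
apply: raddf_inj => p /eqP; apply: contraTeq => pN0.
by rewrite comp_poly_eq0 // size_polyXn ltnS.
Qed.

Definition subst_eps : {rmorphism K -> K} := fracmap comp_polyXn_inj.

Lemma subst_eps_eps : subst_eps (eps R) = eps R ^+ d.
Proof. by rewrite /= fracmap_tofrac /= comp_polyX tofracXn. Qed.

(** Since [d] is positive, ['X^d] vanishes at 0, so composition with it preserves the values at 0 of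
    numerator and denominator. *)
Lemma regular_at0_subst_eps x c : regular_at0 x c -> regular_at0 (subst_eps x) c.
Proof.
move=> [p [q [qN0 -> ->]]].
have comp0 (r : {poly C}) : (r \Po 'X^d).[0] = r.[0].
  by rewrite horner_comp hornerXn expr0n eqn0Ngt d_gt0.
exists (p \Po 'X^d), (q \Po 'X^d); split; rewrite ?comp0 //.
by rewrite /= fracmapE // (@horner_neq0 _ _ 0).
Qed.
End Substitution.

(** * From products of affine forms to sums of powers *)

Section Main.
Variables (R : realType) (n d : nat) (f : {mpoly R[i][n]}).
Hypothesis f_hom : f \is d.-homog.
Local Notation C := R[i].
Local Notation K := {fraction {poly C}}.

Lemma WR_border_repr0 : f = 0 -> WR_border_repr d f 0.
Proof.
move=> f0; exists (fun=> 0); split=> [i|]; first exact: dhomog0.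
apply/mlim0_eqP => m; rewrite big_ord0 f0 !mcoeff0.
exact: (regular_at0_nat R 0).
Qed.

Lemma Kc_minus_coef_neq0 (gamma : C) (x : K) (F : {mpoly K[n]}) :
  f != 0 -> mlim0_eq ((cstK gamma * x) *: F) f -> gamma != 0.
Proof.
move=> + lim_f; apply: contra_neq => gamma0; apply/mpolyP => m.
have := lim_f m; rewrite gamma0 /cstK tofrac0 mul0r scale0r !mcoeff0 => lim_m.
exact/(lim0_eq_uniq lim_m)/regular_at0_lim0_eq/(regular_at0_nat R 0).
Qed.

(** The product has constant term $e_0 = 1$, which the subtraction cancels, so the limit has no
    constant term. *)
Lemma Kc_minus_degree_gt0 (x : K) (m : nat) (l : 'I_m -> {mpoly K[n]}) :
    f != 0 -> (forall i, linform (l i)) ->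
  mlim0_eq (x *: (\prod_(i < m) (1 + l i) - 1)) f -> (0 < d)%N.
Proof.
move=> + l_lin lim_f; rewrite lt0n; apply: contra_neq => d0.
apply/mpolyP => k; rewrite mcoeff0.
have [k0|kN0] := eqVneq (mdeg k) 0%N; last first.
  by apply: (dhomog_nemf_coeff f_hom); rewrite d0.
have := lim_f k; rewrite mcoeffZ mcoeffB mcoeff1 -mdeg_eq0 k0 eqxx.
have -> : \prod_(i < m) (1 + l i) = \prod_(y <- map l (index_enum 'I_m)) (1 + y).
  by rewrite big_map.
rewrite mcoeff_prod_linform => [|_ /mapP[i _ ->]]; last exact: l_lin.
rewrite k0 coef0_esym_poly mcoeff1 -mdeg_eq0 k0 eqxx subrr mulr0 => lim_k.
exact/(lim0_eq_uniq lim_k)/regular_at0_lim0_eq/(regular_at0_nat R 0).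
Qed.

Lemma Kc_minus_WR_border_repr m :
  f != 0 -> Kc_minus_repr f m -> WR_border_repr d f m.
Proof.
move=> fN0 [M [gamma [l [M_gt0 l_laurent lim_f]]]].
have l_lin i : linform (l i) by case: (l_laurent i).
have gammaN0 := Kc_minus_coef_neq0 fN0 lim_f.
have d_gt0 := Kc_minus_degree_gt0 fN0 l_lin lim_f.
set s := map l (index_enum 'I_m).
have s_lin : {in s, forall y, y \is 1.-homog}.
  by move=> _ /mapP[i _ ->]; apply: l_lin.
have epsN0 : eps R != 0 by rewrite tofrac_eq0 polyX_eq0.
set u := eps R ^+ M; have uN0 : u != 0 by rewrite expf_neq0.
have u0 : regular_at0 u 0.
  have := regular_at0_poly ('X^M : {poly C}).
  by rewrite tofracXn hornerXn expr0n eqn0Ngt M_gt0.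
have gammaK : cstK gamma^-1 * cstK gamma = 1.
  by rewrite /cstK -tofracM -polyCM mulVf // tofrac1.
(* [h k] is the limit of $\varepsilon^{-M} e_{k+1}$; the factor [gamma] of the hypothesis is moved
   to the side of [f]. *)
pose h k := if k.+1 == d then gamma^-1 *: f else 0.
have esym_lim k : mregular_at0 (u^-1 *: (esym_poly s)`_k.+1) (h k).
  move=> mm; rewrite mcoeffZ /h.
  have [mk|mNk] := eqVneq (mdeg mm) k.+1; last first.
    rewrite (dhomog_nemf_coeff (coef_esym_poly_homog s_lin _) mNk) mulr0.
    have -> : (if k.+1 == d then gamma^-1 *: f else 0)@_mm = 0.
      case: eqP => [kd|]; last by rewrite mcoeff0.
      by rewrite mcoeffZ (dhomog_nemf_coeff f_hom) ?mulr0 // -kd.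
    exact: (regular_at0_nat R 0).
  (* On monomials of degree [k.+1] the subtracted 1 has no coefficient, and the hypothesis gives the
     limit of $e_{k+1}$. *)
  have := lim_f mm => /lim0_eqP.
  rewrite mcoeffZ mcoeffB mcoeff1 -mdeg_eq0 mk subr0.
  have -> : \prod_(i < m) (1 + l i) = \prod_(y <- s) (1 + y) by rewrite big_map.
  rewrite mcoeff_prod_linform // mk => /(regular_at0M (regular_at0_cst gamma^-1)).
  rewrite -/u !mulrA gammaK mul1r.
  case: eqP => [_|/eqP kNd]; first by rewrite mcoeffZ.
  have -> : f@_mm = 0 by apply: (dhomog_nemf_coeff f_hom); rewrite -mk in kNd.
  by rewrite mulr0 mcoeff0.
have := power_sum_mregular_at0 uN0 u0 esym_lim d.-1.
rewrite prednK // /h prednK // eqxx => pow_lim.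
(* Inverse of the constant $(-1)^{d-1} d/\gamma$ by which the limit of $\varepsilon^{-M} p_d$
   differs from [f]. *)
pose a : C := (-1) ^+ d.-1 * gamma / d%:R.
have a_root : (d.-root a) ^+ d = a by rewrite rootCK.
(* The [d]-th power of this form is $a\,\varepsilon^{-Md}\, l_i(\varepsilon^d)^d$, which is [a]
   times the image of $\varepsilon^{-M} l_i^d$ under $\varepsilon \mapsto \varepsilon^d$. *)
exists (fun i => (cstK (d.-root a) / u) *: map_mpoly (subst_eps R d_gt0) (l i)).
split=> [i|]; first by apply/dhomogZ/map_mpoly_homog/l_lin.
apply/mlim0_eqP.
have -> : f = a *: ((-1) ^+ d.-1 * (gamma^-1 *: f *+ d)).
  rewrite scalerAr scalerMnr -scaler_nat !scalerA.
  have -> : a * (gamma^-1 * d%:R) = (-1) ^+ d.-1.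
    by rewrite /a; field; rewrite gammaN0 pnatr_eq0 -lt0n.
  rewrite -signr_odd -[in X in _ * X]signr_odd.
  by case: odd; rewrite ?expr1 ?mulN1r ?scaleN1r ?opprK // mul1r scale1r.
rewrite [X in mregular_at0 X](_ : _ =
  cstK a *: map_mpoly (subst_eps R d_gt0) (u^-1 *: \sum_(y <- s) y ^+ d)); last first.
  rewrite map_mpolyZ scalerA rmorph_sum big_map scaler_sumr.
  apply: eq_bigr => i _; rewrite exprZn rmorphXn; congr (_ *: _).
  rewrite exprMn /cstK -tofracXn -polyC_exp a_root; congr (_ * _).
  by rewrite fmorphV rmorphXn /= subst_eps_eps exprVn -exprM mulnC exprM.
apply: mregular_at0Z; first exact: regular_at0_cst.
by move=> mm; rewrite mcoeff_map_mpoly; apply/regular_at0_subst_eps/pow_lim.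
Qed.
End Main.

Theorem mainTheorem4 (R : realType) (n d : nat) (f : {mpoly R[i][n]}) :
  f \is d.-homog -> (WR_border d f <= Kc_minus_border f)%E.
Proof.
(* It suffices to bound the border rank by each admissible [m]; this includes the case where there
   is none and the infimum is [+oo]. The zero form is treated apart, as [gamma] or [d] may then
   vanish. *)
move=> f_hom; apply: le_ereal_inf_tmp => _ [m fm <-].
have [f0|fN0] := eqVneq f 0.
  apply: (@le_trans _ _ (0%:R)%:E); last by rewrite lee_fin ler_nat.
  by apply: ereal_inf_lbound; exists 0%N => //; apply: WR_border_repr0.
by apply: ereal_inf_lbound; exists m => //; apply: Kc_minus_WR_border_repr.
Qed.
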